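(* Let $K$ be a field, let $q\ge 0$ and $r\ge 1$ be integers, and let $L=I_qJ_r+I_{q+1}J_{r-1}\subset K[x_1,\dots,x_n,y_1,\dots,y_m]$, where $I_a$ is generated by all squarefree monomials of degree $a$ in $K[x_1,\dots,x_n]$ and $J_b$ is generated by all squarefree monomials of degree $b$ in $K[y_1,\dots,y_m]$. Then $L$ is matroidal.
   Context: For integers $a,b\ge 0$, $I_a$ (resp. $J_b$) denotes the squarefree Veronese ideal generated by all squarefree monomials of degree $a$ in $x_1,\dots,x_n$ (resp. of degree $b$ in $y_1,\dots,y_m$); in particular $I_0$ and $J_0$ are the unit ideal. Sums and products are formed in $K[x_1,\dots,x_n,y_1,\dots,y_m]$ after extending the ideals to that ring. For a monomial ideal $I$ in a polynomial ring, $G(I)$ is its unique minimal set of monomial generators. A monomial ideal $I$ generated in a single degree is polymatroidal if for any $u,v\in G(I)$ and any variable $z$ with $\deg_z(u)>\deg_z(v)$ there is a variable $w$ with $\deg_w(u)<\deg_w(v)$ such that $w(u/z)\in I$. It is matroidal if it is polymatroidal and generated by squarefree monomials. *)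

(* Defs.v *)
From HB Require Import structures.
From mathcomp Require Import all_boot all_order all_algebra.
From mathcomp.multinomials Require Import mpoly.

Set Implicit Arguments.
Unset Strict Implicit.
Unset Printing Implicit Defensive.

Import GRing.Theory.
Local Open Scope ring_scope.

(* Ideals are Prop-valued subsets of a commutative ring, compared
   extensionally; no decidability of membership is assumed. *)
Section Ideals.
Variable R : comNzRingType.

Definition ideal_eq (I J : R -> Prop) : Prop := forall p, I p <-> J p.

Definition ideal_gen (S : R -> Prop) (p : R) : Prop :=
  exists (k : nat) (c s : 'I_k -> R),
    (forall i, S (s i)) /\ p = \sum_(i < k) c i * s i.

Definition ideal_add (I J : R -> Prop) (p : R) : Prop :=
  exists a b : R, [/\ I a, J b & p = a + b].

Definition ideal_mul (I J : R -> Prop) : R -> Prop :=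
  ideal_gen (fun p => exists a b : R, [/\ I a, J b & p = a * b]).

End Ideals.

Definition ideal_ext (R R' : comNzRingType) (f : R -> R') (I : R -> Prop) :
    R' -> Prop :=
  ideal_gen (fun p => exists2 a, I a & p = f a).

(* A monomial is represented by its exponent vector u : 'X_{1..N}. *)
Section MonomialIdeals.
Variables (N : nat) (K : fieldType).

Definition squarefree (u : 'X_{1..N}) : Prop := forall i : 'I_N, (u i <= 1)%N.

Definition monomial_ideal (S : 'X_{1..N} -> Prop) : {mpoly K[N]} -> Prop :=
  ideal_gen (fun p => exists2 u, S u & p = 'X_[u]).

(* G = G(I): G generates I and no proper subset of G does.  In particular I is
   a monomial ideal; such a G is unique, see [is_min_gens_uniq]. *)
Definition is_min_gens (I : {mpoly K[N]} -> Prop) (G : 'X_{1..N} -> Prop) :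
    Prop :=
  ideal_eq I (monomial_ideal G) /\
  (forall S : 'X_{1..N} -> Prop,
     (forall u, S u -> G u) -> ideal_eq I (monomial_ideal S) ->
     forall u, G u -> S u).

(* The exponent vector of w * (u / z) is u - U_(z) + U_(w); the truncated
   subtraction is exact because z divides u whenever v z < u z. *)
Definition polymatroidal (I : {mpoly K[N]} -> Prop) : Prop :=
  exists G : 'X_{1..N} -> Prop,
    [/\ is_min_gens I G,
        exists d : nat, forall u, G u -> mdeg u = d
      & forall u v, G u -> G v -> forall z : 'I_N, (v z < u z)%N ->
        exists w : 'I_N, (u w < v w)%N /\ I 'X_[(u - U_(z) + U_(w))%MM]].

Definition matroidal (I : {mpoly K[N]} -> Prop) : Prop :=
  polymatroidal I /\
  exists S : 'X_{1..N} -> Prop,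
    (forall u, S u -> squarefree u) /\ ideal_eq I (monomial_ideal S).

Definition sqfree_veronese (a : nat) : {mpoly K[N]} -> Prop :=
  monomial_ideal (fun u => squarefree u /\ mdeg u = a).

End MonomialIdeals.

Arguments sqfree_veronese : clear implicits.

(* K[x_1..x_n, y_1..y_m] is {mpoly K[n + m]}, the variables x being the first n
   and the variables y the last m. *)
Section TwoSetsOfVariables.
Variables (K : fieldType) (n m : nat).

Definition embx (p : {mpoly K[n]}) : {mpoly K[n + m]} :=
  p \mPo [tuple 'X_(lshift m i) | i < n].

Definition emby (p : {mpoly K[m]}) : {mpoly K[n + m]} :=
  p \mPo [tuple 'X_(rshift n j) | j < m].

Definition I_ (a : nat) : {mpoly K[n + m]} -> Prop :=
  ideal_ext embx (sqfree_veronese n K a).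

Definition J_ (b : nat) : {mpoly K[n + m]} -> Prop :=
  ideal_ext emby (sqfree_veronese m K b).

End TwoSetsOfVariables.

Arguments I_ : clear implicits.
Arguments J_ : clear implicits.

Lemma ideal_gen_le (R : comNzRingType) (S T : R -> Prop) :
  (forall p, S p -> ideal_gen T p) -> forall p, ideal_gen S p -> ideal_gen T p.
Proof.
move=> ST p [k [c [s [Ss ->]]]]; apply: big_ind => [|a b|i _].
- exists 0%N, (fun _ => 0), (fun _ => 0); split=> [[] //|].
  by rewrite big_ord0.
- move=> [k1 [c1 [s1 [T1 ->]]]] [k2 [c2 [s2 [T2 ->]]]].
  pose h T (f1 : 'I_k1 -> T) f2 (i : 'I_(k1 + k2)) :=
    match split i with inl j => f1 j | inr j => f2 j end.
  exists (k1 + k2)%N, (h _ c1 c2), (h _ s1 s2); split=> [i|].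
    by rewrite /h; case: split.
  rewrite big_split_ord /=; congr (_ + _); apply: eq_bigr => i _.
    by rewrite /h -[lshift _ _]/(unsplit (inl i)) unsplitK.
  by rewrite /h -[rshift _ _]/(unsplit (inr i)) unsplitK.
have [k1 [c1 [s1 [T1 ->]]]] := ST _ (Ss i).
exists k1, (fun j => c i * c1 j), s1; split=> //.
by rewrite mulr_sumr; apply: eq_bigr => j _; rewrite mulrA.
Qed.

Lemma monomial_idealX (N : nat) (K : fieldType) (S : 'X_{1..N} -> Prop)
    (u : 'X_{1..N}) :
  monomial_ideal S ('X_[u] : {mpoly K[N]}) <-> exists2 s, S s & (s <= u)%MM.
Proof.
split=> [[k [c [s [Ss e]]]]|[s Ss le_su]]; last first.
  exists 1%N, (fun _ => 'X_[u - s]), (fun _ => 'X_[s]); split=> [_|].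
    by exists s.
  by rewrite big_ord1 -mpolyXD submK.
have: ('X_[u] : {mpoly K[N]})@_u != 0 by rewrite mcoeffX eqxx oner_eq0.
rewrite e raddf_sum /= => nz.
have [i nzi] : exists i, (c i * s i)@_u != 0.
  apply/existsP; apply: contraNT nz => /existsPn h.
  by rewrite big1 // => i _; apply/eqP; have := h i; rewrite negbK.
have [t St est] := Ss i; exists t => //.
move: nzi; rewrite est -mcoeff_msupp => /msuppM_le /allpairsP[[a b] /= [_ hb ->]].
by move: hb; rewrite msuppX inE => /eqP ->; apply: lem_addl.
Qed.

Lemma is_min_gens_uniq (N : nat) (K : fieldType) (I : {mpoly K[N]} -> Prop)
    (G G' : 'X_{1..N} -> Prop) :
  is_min_gens I G -> is_min_gens I G' -> forall u, G u <-> G' u.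
Proof.
suff sub A B : is_min_gens I A -> is_min_gens I B -> forall u, A u -> B u.
  by move=> hG hG' u; split; apply: sub.
move=> [IA minA] [IB _] u Au.
have /(IB _)/monomial_idealX[t Bt le_tu] : I 'X_[u].
  by apply/(IA _)/monomial_idealX; exists u => //; apply: lepm_refl.
have /(IA _)/monomial_idealX[s As le_st] : I 'X_[t].
  by apply/(IB _)/monomial_idealX; exists t => //; apply: lepm_refl.
have [eq_su|ne_su] := eqVneq s u.
  suff <- : t = u by [].
  apply/mnmP => i; apply/eqP; rewrite eqn_leq (mnm_lepP le_tu).
  by rewrite -{1}eq_su (mnm_lepP le_st).
suff [_ []] : A u /\ u <> u by [].
apply: (minA (fun v => A v /\ v <> u)) => // [v [] //|p].
rewrite (IA p); split; apply: ideal_gen_le => _ [v Av ->].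
  apply/monomial_idealX; have [->|/eqP ne_vu] := eqVneq v u.
    exists s; first by split=> //; apply/eqP.
    exact: lepm_trans le_st le_tu.
  by exists v => //; apply: lepm_refl.
by apply/monomial_idealX; exists v; [case: Av|apply: lepm_refl].
Qed.

(* Main.v *)
Require Import Defs.
From mathcomp Require Import all_boot all_order all_algebra.
From mathcomp.multinomials Require Import mpoly.
From mathcomp Require Import zify.

(** Multiplying out, L is generated by the squarefree monomials of degree
    [q + r] whose degree in the x-variables is [q] or [q + 1]; the two summands
    of L account for the two values.  These monomials are the minimal generators,
    because distinct monomials of the same degree do not divide each other.

    The exchange property holds more generally for the squarefree monomials of
    degree [d] whose degree in a set [A] of variables lies in an interval
    [lo..hi] ([band], [matroidal_band]).  Let [z] divide [u] and not [v].  If some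
    variable [w] on the same side of [A] as [z] divides [v] and not [u], trading
    [z] for [w] leaves the degree in [A] alone.  Otherwise [v] has smaller degree
    than [u] on the side of [z], hence larger degree on the other side, where a
    suitable [w] must exist; trading [z] for it moves the degree of [u] in [A] one
    step towards that of [v], so it stays in the interval
    ([exchange_keeps_deg_in]). *)

Set Implicit Arguments.
Unset Strict Implicit.
Unset Printing Implicit Defensive.

(** * Degrees in a set of variables *)

Section DegIn.
Local Open Scope nat_scope.
Variable N : nat.
Implicit Types (A : pred 'I_N) (u v : 'X_{1..N}) (z w : 'I_N).

Definition deg_in A u : nat := \sum_(i < N | A i) u i.

Lemma mdeg_split A u : mdeg u = deg_in A u + deg_in (predC A) u.
Proof. by rewrite mdegE (bigID A). Qed.

Lemma deg_inD A u v : deg_in A (u + v)%MM = deg_in A u + deg_in A v.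
Proof. by rewrite /deg_in -big_split; apply: eq_bigr => i _; rewrite mnmDE. Qed.

Lemma deg_in1 A z : deg_in A U_(z)%MM = A z.
Proof.
rewrite /deg_in; under eq_bigr do rewrite mnm1E.
have [Az|nAz] := boolP (A z).
  rewrite (bigD1 z) //= eqxx big1 // => i /andP[_ ne_iz].
  by rewrite eq_sym (negPf ne_iz).
by rewrite big1 // => i Ai; case: eqP => // eq_zi; rewrite eq_zi Ai in nAz.
Qed.

(** Stated without subtraction, so that one formula covers the four positions of
    [z] and [w] relative to [A]. *)
Lemma deg_in_swap A u z w : 0 < u z ->
  deg_in A (u - U_(z) + U_(w))%MM + A z = deg_in A u + A w.
Proof.
move=> uz; have le_zu : (U_(z) <= u)%MM by rewrite lep1mP -lt0n.
by rewrite -[in RHS](submK le_zu) !deg_inD !deg_in1 addnAC.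
Qed.

Lemma deg_in_lt A u v : deg_in A u < deg_in A v ->
  exists2 w, A w & u w < v w.
Proof.
move=> lt_uv; have [|none] := boolP [exists w, A w && (u w < v w)].
  by case/existsP=> w /andP[]; exists w.
suff: deg_in A v <= deg_in A u by rewrite leqNgt lt_uv.
apply: leq_sum => w Aw; rewrite leqNgt.
by apply: contra none => lt_w; apply/existsP; exists w; rewrite Aw.
Qed.

Lemma gain_or_deg_in_lt A u v z : A z -> v z < u z ->
  (exists2 w, A w & u w < v w) \/ deg_in A v < deg_in A u.
Proof.
move=> Az lt_z; have [le_uv|] := leqP (deg_in A u) (deg_in A v); last by right.
left; move: le_uv; rewrite /deg_in !(bigD1 (P := A) z Az) /= => le_uv.
have [|w /andP[Aw _] lt_w] := @deg_in_lt [pred i | A i & i != z] u v.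
  by rewrite -(ltn_add2l (u z)); apply: leq_ltn_trans le_uv _; rewrite ltn_add2r.
by exists w.
Qed.

Lemma exchange_in_block A u v z : A z -> mdeg u = mdeg v -> v z < u z ->
  exists2 w, u w < v w & A w || (deg_in A v < deg_in A u).
Proof.
move=> Az; rewrite !(mdeg_split A) => eq_deg lt_z.
have [[w Aw lt_w]|lt_vu] := gain_or_deg_in_lt Az lt_z.
  by exists w => //; rewrite Aw.
have [|w _ lt_w] := @deg_in_lt (predC A) u v; first by lia.
by exists w; rewrite // lt_vu orbT.
Qed.

(** Only the block containing [z] matters, and [A] and its complement play
    symmetric parts as [u] and [v] have the same degree; so the case where [z] is
    outside [A] is the previous lemma for the complement. *)
Lemma exchange_keeps_deg_in A u v z : mdeg u = mdeg v -> v z < u z ->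
  exists2 w, u w < v w &
    minn (deg_in A u) (deg_in A v) <= deg_in A (u - U_(z) + U_(w))%MM
      <= maxn (deg_in A u) (deg_in A v).
Proof.
move=> eq_deg lt_z; have uz : 0 < u z by apply: leq_ltn_trans lt_z.
move: (eq_deg); rewrite !(mdeg_split A) => eq_degA.
have [Az|nAz] := boolP (A z).
  have [w lt_w Aw] := exchange_in_block Az eq_deg lt_z.
  exists w => //; have := deg_in_swap A w uz; rewrite Az.
  by case: (A w) Aw => /= Aw; lia.
have [w lt_w Aw] := exchange_in_block (A := predC A) nAz eq_deg lt_z.
exists w => //; have := deg_in_swap A w uz; rewrite (negPf nAz).
by move: Aw => /=; case: (A w) => /= Aw; lia.
Qed.

Definition band A d lo hi u : Prop :=
  [/\ squarefree u, mdeg u = d & lo <= deg_in A u <= hi].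

Lemma band_exchange A d lo hi u v z :
  band A d lo hi u -> band A d lo hi v -> v z < u z ->
  exists2 w, u w < v w & band A d lo hi (u - U_(z) + U_(w))%MM.
Proof.
move=> [sfu du Au] [sfv dv Av] lt_z.
have [|w lt_w Auw] := exchange_keeps_deg_in A _ lt_z; first by rewrite du.
exists w => //; split; last by lia.
- move=> i; rewrite mnmDE mnmBE !mnm1E; have := sfu i; have := sfv w.
  by case: (eqVneq w i) => [<-|_]; case: (z == _); lia.
- have le_zu : (U_(z) <= u)%MM by rewrite lep1mP; lia.
  by rewrite mdegD mdeg1 -du -[in RHS](submK le_zu) mdegD mdeg1.
Qed.

End DegIn.

(** * Matroidal ideals from bands *)

Section MinGens.
Local Open Scope ring_scope.
Variables (N : nat) (K : fieldType).
Implicit Types (I : {mpoly K[N]} -> Prop) (G : 'X_{1..N} -> Prop).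

Lemma lepm_mdeg_eq (u v : 'X_{1..N}) : (u <= v)%MM -> mdeg u = mdeg v -> u = v.
Proof.
move=> le_uv eq_deg; have := congr1 (@mdeg N) (submK le_uv); rewrite mdegD.
rewrite eq_deg -[RHS]add0n => /addIn/eqP; rewrite mdeg_eq0 => /eqP vu0.
by rewrite -(submK le_uv) vu0 add0m.
Qed.

(** Among monomials of one degree only [u] itself divides [u], so no generator is
    redundant. *)
Lemma is_min_gens_equigenerated I G d :
  ideal_eq I (monomial_ideal G) -> (forall u, G u -> mdeg u = d) ->
  is_min_gens I G.
Proof.
move=> IG degG; split=> // S subSG IS u Gu.
have /(IS _)/monomial_idealX[s Ss le_su] : I 'X_[u].
  by apply/(IG _)/monomial_idealX; exists u => //; apply: lepm_refl.
by rewrite -(lepm_mdeg_eq le_su) // !degG //; apply: subSG.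
Qed.

Lemma matroidal_band I (A : pred 'I_N) d lo hi :
  ideal_eq I (monomial_ideal (band A d lo hi)) -> matroidal I.
Proof.
move=> IB; have degB u : band A d lo hi u -> mdeg u = d by case.
split; exists (band A d lo hi); last by split=> // u [].
split; [exact: is_min_gens_equigenerated degB | by exists d |].
move=> u v Bu Bv z lt_z; have [w lt_w Bw] := band_exchange Bu Bv lt_z.
exists w; split=> //; apply/(IB _)/monomial_idealX.
by exists (u - U_(z) + U_(w))%MM => //; apply: lepm_refl.
Qed.

End MinGens.

(** * Sums, products and extensions of generated ideals *)

Section GeneratedIdeals.
Local Open Scope ring_scope.
Import GRing.Theory.
Variable R : comNzRingType.
Implicit Types S T : R -> Prop.

Lemma ideal_gen_in S p : S p -> ideal_gen S p.
Proof.
by exists 1%N, (fun=> 1), (fun=> p); split=> //; rewrite big_ord1 mul1r.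
Qed.

(** Generators that already lie in an ideal generate nothing new: this is what
    makes a generated ideal closed under linear combinations. *)
Lemma ideal_gen_lin S k (c s : 'I_k -> R) :
  (forall i, ideal_gen S (s i)) -> ideal_gen S (\sum_(i < k) c i * s i).
Proof.
by move=> Ss; apply: (@ideal_gen_le _ (ideal_gen S)) => //; exists k, c, s.
Qed.

Lemma ideal_gen_mul S c p : ideal_gen S p -> ideal_gen S (c * p).
Proof.
move=> Sp; have := @ideal_gen_lin S 1 (fun=> c) (fun=> p) (fun=> Sp).
by rewrite big_ord1.
Qed.

Lemma ideal_gen_add S p p' :
  ideal_gen S p -> ideal_gen S p' -> ideal_gen S (p + p').
Proof.
move=> Sp Sp'; pose s (i : 'I_2) := if i == ord0 then p else p'.
have := @ideal_gen_lin S 2 (fun=> 1) s.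
by rewrite !big_ord_recl big_ord0 !mul1r addr0; apply=> i; rewrite /s; case: ifP.
Qed.

Lemma ideal_add_gen (I J : R -> Prop) S T :
  ideal_eq I (ideal_gen S) -> ideal_eq J (ideal_gen T) ->
  ideal_eq (ideal_add I J) (ideal_gen (fun p => S p \/ T p)).
Proof.
move=> IS JT p; split=> [[a [b [/IS Sa /JT Tb ->]]]|[k [c [s [STs ->]]]]].
  apply: ideal_gen_add; [move: Sa | move: Tb]; apply: ideal_gen_le => x ?;
    apply: ideal_gen_in; by [left | right].
elim/big_rec: _ => [|i x _ [a [b [/IS Sa /JT Tb ->]]]].
  have nil P : ideal_gen P (0 : R).
    by exists 0%N, (fun=> 0), (fun=> 0); split=> [[]|]; rewrite ?big_ord0.
  by exists 0, 0; split; [apply/IS | apply/JT | rewrite addr0].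
have [Si|Ti] := STs i.
  exists (c i * s i + a), b; split; [apply/IS | exact/JT | exact: addrA].
  by apply: ideal_gen_add => //; apply/ideal_gen_mul/ideal_gen_in.
exists a, (c i * s i + b); split; [exact/IS | apply/JT | exact: addrCA].
by apply: ideal_gen_add => //; apply/ideal_gen_mul/ideal_gen_in.
Qed.

Lemma ideal_mul_gen (I J : R -> Prop) S T :
  ideal_eq I (ideal_gen S) -> ideal_eq J (ideal_gen T) ->
  ideal_eq (ideal_mul I J)
    (ideal_gen (fun p => exists a b, [/\ S a, T b & p = a * b])).
Proof.
move=> IS JT p; split; apply: ideal_gen_le => _ [a [b [aP bP ->]]]; last first.
  apply: ideal_gen_in; exists a, b.
  by split=> //; [apply/IS | apply/JT]; apply: ideal_gen_in.
have [k [c [s [Ss ->]]]] := (IS _).1 aP; have [l [e [t [Tt ->]]]] := (JT _).1 bP.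
rewrite mulr_suml; under eq_bigr do rewrite -mulrA.
apply: ideal_gen_lin => i; rewrite mulr_sumr.
under eq_bigr do rewrite mulrCA.
by apply: ideal_gen_lin => j; apply: ideal_gen_in; exists (s i), (t j).
Qed.

Lemma eq_ideal_gen (I : R -> Prop) S T :
  ideal_eq I (ideal_gen S) -> (forall p, S p <-> T p) -> ideal_eq I (ideal_gen T).
Proof.
move=> IS ST p; rewrite (IS p); split; apply: ideal_gen_le => x xP;
  by apply: ideal_gen_in; apply/ST.
Qed.

End GeneratedIdeals.

Section Extension.
Local Open Scope ring_scope.
Import GRing.Theory.

Lemma ideal_ext_gen (R R' : comNzRingType) (f : {rmorphism R -> R'})
    (S : R -> Prop) :
  ideal_eq (ideal_ext f (ideal_gen S))
    (ideal_gen (fun p => exists2 a, S a & p = f a)).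
Proof.
move=> p; split; apply: ideal_gen_le => _ [a Sa ->]; last first.
  by apply: ideal_gen_in; exists a => //; apply: ideal_gen_in.
have [k [c [s [Ss ->]]]] := Sa; rewrite rmorph_sum.
under eq_bigr do rewrite rmorphM.
by apply: ideal_gen_lin => i; apply: ideal_gen_in; exists (s i).
Qed.

End Extension.

(** * Two blocks of variables *)

Section TwoBlocks.
Local Open Scope ring_scope.
Import GRing.Theory.
Variables (K : fieldType) (n m : nat).

Definition xvar : pred 'I_(n + m) := fun i => (i < n)%N.

Definition mnm_join (u : 'X_{1..n}) (v : 'X_{1..m}) : 'X_{1..(n + m)} :=
  [multinom match split i with inl j => u j | inr j => v j end | i < n + m].

Lemma mnm_joinl u v i : mnm_join u v (lshift m i) = u i.
Proof. by rewrite mnmE -[lshift _ _]/(unsplit (inl i)) unsplitK. Qed.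

Lemma mnm_joinr u v i : mnm_join u v (rshift n i) = v i.
Proof. by rewrite mnmE -[rshift _ _]/(unsplit (inr i)) unsplitK. Qed.

Lemma mnm_join_split (w : 'X_{1..(n + m)}) :
  w = mnm_join [multinom w (lshift m i) | i < n] [multinom w (rshift n i) | i < m].
Proof.
apply/mnmP => i; rewrite -[i]splitK; case: (split i) => j /=.
  by rewrite mnm_joinl mnmE.
by rewrite mnm_joinr mnmE.
Qed.

Lemma deg_in_join u v : deg_in xvar (mnm_join u v) = mdeg u.
Proof.
rewrite /deg_in big_split_ord /= mdegE [X in (_ + X)%N]big_pred0 ?addn0.
  by apply: eq_big => i; rewrite /xvar /= ?ltn_ord // mnm_joinl.
by move=> i; rewrite /xvar /= ltnNge leq_addr.
Qed.

Lemma mdeg_join u v : mdeg (mnm_join u v) = (mdeg u + mdeg v)%N.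
Proof.
rewrite !mdegE big_split_ord /=.
by congr (_ + _)%N; apply: eq_bigr => i _; rewrite ?mnm_joinl ?mnm_joinr.
Qed.

Lemma squarefree_join u v :
  squarefree (mnm_join u v) <-> squarefree u /\ squarefree v.
Proof.
split=> [sf|[sfu sfv] i].
  by split=> i; [rewrite -(mnm_joinl u v) | rewrite -(mnm_joinr u v)].
rewrite -[i]splitK; case: (split i) => j /=.
  by rewrite mnm_joinl.
by rewrite mnm_joinr.
Qed.

Lemma embxX_embyX (u : 'X_{1..n}) (v : 'X_{1..m}) :
  embx m 'X_[u] * emby n 'X_[v] = 'X_[mnm_join u v] :> {mpoly K[n + m]}.
Proof.
rewrite /embx /emby !comp_mpolyX [in RHS]mpolyXE_id big_split_ord /=.
by congr (_ * _); apply: eq_bigr => i _; rewrite tnth_mktuple ?mnm_joinl ?mnm_joinr.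
Qed.

Lemma I_gens a :
  ideal_eq (I_ K n m a)
    (ideal_gen (fun p => exists2 u, squarefree u /\ mdeg u = a
                                  & p = embx m 'X_[u])).
Proof.
apply: eq_ideal_gen (ideal_ext_gen
  (comp_mpoly [tuple 'X_(lshift m i) | i < n] : {rmorphism _ -> _}) _) _ => p.
by split=> [[_ [u ? ->] ->]|[u ? ->]]; [exists u | exists 'X_[u] => //; exists u].
Qed.

Lemma J_gens b :
  ideal_eq (J_ K n m b)
    (ideal_gen (fun p => exists2 v, squarefree v /\ mdeg v = b
                                  & p = emby n 'X_[v])).
Proof.
apply: eq_ideal_gen (ideal_ext_gen
  (comp_mpoly [tuple 'X_(rshift n j) | j < m] : {rmorphism _ -> _}) _) _ => p.
by split=> [[_ [u ? ->] ->]|[u ? ->]]; [exists u | exists 'X_[u] => //; exists u].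
Qed.

Lemma veronese_mul_band a b :
  ideal_eq (ideal_mul (I_ K n m a) (J_ K n m b))
    (monomial_ideal (band xvar (a + b) a a)).
Proof.
apply: eq_ideal_gen (ideal_mul_gen (I_gens a) (J_gens b)) _ => p.
split=> [[_ [_ [[u [sfu <-] ->] [v [sfv <-] ->] ->]]]|[w [sfw dw aw] ->]].
  exists (mnm_join u v); last exact: embxX_embyX.
  split; [exact/squarefree_join | exact: mdeg_join |].
  by rewrite deg_in_join leqnn.
move: sfw dw aw; rewrite [w]mnm_join_split; set u := Multinom _; set v := Multinom _.
rewrite squarefree_join mdeg_join deg_in_join => -[sfu sfv] dw.
rewrite -eqn_leq => /eqP du; exists (embx m 'X_[u]), (emby n 'X_[v]); split.
- by exists u.
- by exists v => //; split=> //; lia.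
- by rewrite embxX_embyX.
Qed.

End TwoBlocks.

Theorem theorem2p3 (K : fieldType) (n m q r : nat) (hr : (0 < r)%N) :
  matroidal
    (ideal_add (ideal_mul (I_ K n m q) (J_ K n m r))
               (ideal_mul (I_ K n m q.+1) (J_ K n m r.-1))).
Proof.
apply: (@matroidal_band _ _ _ (@xvar n m) (q + r) q q.+1).
apply: eq_ideal_gen (ideal_add_gen (veronese_mul_band q r)
                                   (veronese_mul_band q.+1 r.-1)) _ => p.
have -> : q.+1 + r.-1 = q + r by lia.
split=> [[] [u [sfu du au] ->]|[u [sfu du au] ->]].
- by exists u => //; split=> //; lia.
- by exists u => //; split=> //; lia.
have [le_q|lt_q] := leqP (deg_in (@xvar n m) u) q.
  by left; exists u => //; split=> //; lia.
by right; exists u => //; split=> //; lia.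
Qed.
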